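(* Let $(N_k)_{k\ge1}$ be a sequence of even positive integers with $N_k\to\infty$, let $m_k=N_k/2$, and let $(c_k)_{k\ge1}$ be a sequence of integers with $1\le c_k\le N_k/2$ and $c_k/N_k^{1/2}\to1$. Let $Y_k$ be a random variable with the maximum negative hypergeometric distribution with parameters $(N_k,m_k,c_k)$. Then, as $k\to\infty$, $Y_k/(2c_k)^{1/2}$ converges in distribution to the standard half-normal distribution, i.e. the distribution of $|Z|$ with $Z$ standard normal, which has density $(2/\pi)^{1/2}\exp(-x^2/2)$ for $x\ge0$.
   Context: For a real number $z$ and integer $k\ge1$, $z^{(k)}=z(z-1)\cdots(z-k+1)$ is the falling factorial, and $z^{(0)}=1$. Maximum negative hypergeometric distribution with integer parameters $(N,m,c)$, where $1\le c\le m<N$ and $c\le N-m$: an urn contains $N$ balls, $m$ of one color and $N-m$ of another; balls are drawn without replacement until at least $c$ balls of both colors have been observed; $Y$ is the number of draws needed minus $2c$. Its probability mass function is $$\Pr[Y=y]=\binom{2c+y-1}{c-1}\,\frac{m^{(c+y)}(N-m)^{(c)}+m^{(c)}(N-m)^{(c+y)}}{N^{(2c+y)}},\qquad 0\le y\le\max\{m-c,\,N-m-c\},$$ and $\Pr[Y=y]=0$ for other $y$. *)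

(* Defs.v *)
From HB Require Import structures.
From mathcomp Require Import all_boot all_order all_algebra.
From mathcomp Require Import all_classical all_reals all_analysis.
From mathcomp Require Import measurable_realfun.

Set Implicit Arguments.
Unset Strict Implicit.
Unset Printing Implicit Defensive.

Import Order.TTheory GRing.Theory Num.Theory.
Import numFieldNormedType.Exports.

Local Open Scope classical_set_scope.
Local Open Scope ring_scope.

(* All arguments are natural numbers, so the falling factorial z^(k) is       *)
(* ssrnat's z ^_ k; for 1 <= c <= m < N and c <= N - m every truncated        *)
(* subtraction below is exact.                                                *)
Definition max_neg_hypergeometric_pmf {R : realType} (N m c y : nat) : R :=
  if (y <= maxn (m - c) (N - m - c))%N then
    'C(2 * c + y - 1, c - 1)%:R *
      ((m ^_ (c + y) * (N - m) ^_ c)%:R + (m ^_ c * (N - m) ^_ (c + y))%:R) /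
      (N ^_ (2 * c + y))%:R
  else 0.

Definition max_neg_hypergeometric (d : measure_display) (T : measurableType d)
    (R : realType) (P : probability T R) (N m c : nat) (Y : {RV P >-> nat}) :=
  forall y : nat,
    P (Y @^-1` [set y]) = (max_neg_hypergeometric_pmf N m c y : R)%:E.

Section ratio.
Context d (T : measurableType d) (R : realType) (P : probability T R).
Variables (Y : {RV P >-> nat}) (a : R).

Definition RV_ratio (w : T) : R := (Y w)%:R / a.

Let measurable_RV_ratio : measurable_fun [set: T] RV_ratio.
Proof.
apply: (@measurableT_comp _ _ _ _ _ _ (fun n : nat => n%:R / a : R)) => //.
Qed.

HB.instance Definition _ :=
  isMeasurableFun.Build _ _ _ _ RV_ratio measurable_RV_ratio.

End ratio.

Section half_normal.
Context (R : realType).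

Definition half_normal_RV (z : measurableTypeR R) : measurableTypeR R := `|z|.

HB.instance Definition _ :=
  @isMeasurableFun.Build _ _ _ _ half_normal_RV (@normr_measurable R setT).

Definition half_normal_prob : probability (measurableTypeR R) R :=
  distribution (normal_prob (0 : R) 1) half_normal_RV.

(* Consistency check: the usual half-normal density. *)
Lemma half_normal_prob_density (A : set (measurableTypeR R)) : measurable A ->
  half_normal_prob A =
  (\int[lebesgue_measure]_(x in A `&` `[0%R, +oo[%classic)
     (Num.sqrt (2 / pi) * expR (- x ^+ 2 / 2))%:E)%E.
Proof.
move=> mA; pose f x : \bar R := (normal_pdf (0 : R) 1 x)%:E.
pose B : set (measurableTypeR R) := half_normal_RV @^-1` A.
have mB : measurable B.
  by rewrite /B -[X in measurable X]setTI; exact: normr_measurable.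
have mf : measurable_fun [set: R] f.
  by apply/measurable_EFinP; exact: measurable_normal_pdf.
have f0 x : (0 <= f x)%E by rewrite lee_fin normal_pdf_ge0.
pose g := f \_ B.
have mg : measurable_fun [set: R] g.
  by apply/(measurable_restrictT _ _).1 => //; exact: measurable_funTS.
have g0 x : (0 <= g x)%E by exact: erestrict_ge0.
have gN x : g (- x) = g x.
  have fN : f (- x) = f x.
    by rewrite /f /normal_pdf oner_eq0 /normal_fun !subr0 sqrrN.
  have BN : (- x \in B) = (x \in B).
    by apply/idP/idP; rewrite !inE /B /preimage /half_normal_RV /= normrN.
  by rewrite /g /patch BN fN.
have -> : half_normal_prob A = (\int[lebesgue_measure]_x g x)%E.
  by rewrite -integral_mkcond.
have I0 : (\int[lebesgue_measure]_(x in `]-oo, 0%R[) g x =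
           \int[lebesgue_measure]_(x in `[0%R, +oo[) g x)%E.
  rewrite integral_itv_bndo_bndc; last exact: measurable_funTS.
  rewrite [RHS]ge0_integration_by_substitution0//.
  by apply: eq_integral => x _; rewrite gN.
have UT : [set: R] = `]-oo, 0%R[ `|` `[0%R, +oo[.
  by rewrite -setCitvr setvU.
rewrite [in LHS]UT ge0_integral_setU//; last 2 first.
  by rewrite -UT.
  by rewrite -setCitvr; apply/disj_setPLR.
rewrite I0 -ge0_integralD//; try exact: measurable_funTS.
rewrite integral_mkcondl; apply: eq_integral => x.
rewrite inE/= in_itv/= andbT => x0.
rewrite /g /patch.
have -> : (x \in B) = (x \in A).
  by apply/idP/idP; rewrite !inE /B /preimage /half_normal_RV /= ger0_norm.
case: ifP => _; last by rewrite adde0.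
rewrite /f -EFinD; congr EFin.
rewrite /normal_pdf oner_eq0 /normal_peak /normal_fun subr0 expr1n mul1r.
rewrite -mulr2n -mulrnAl; congr (_ * expR (_ / _)).
have -> : 2 / pi = 2 ^+ 2 * (pi *+ 2)^-1 :> R.
  by rewrite -[pi *+ 2]mulr_natl invfM mulrA expr2 mulfK.
rewrite sqrtrM ?exprn_ge0// sqrtr_sqr ger0_norm// sqrtrV ?mulr_natl//.
by rewrite mulrn_wge0// pi_ge0.
Qed.

End half_normal.

(* Pointwise convergence of the distribution functions at the continuity      *)
(* points of the limit; the X k may live on different probability spaces.    *)
Definition cvg_in_distribution (R : realType) (d : nat -> measure_display)
    (T : forall k, measurableType (d k)) (P : forall k, probability (T k) R)
    (X : forall k, {RV P k >-> R}) (mu : probability (measurableTypeR R) R) :=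
  forall x : R, {for x, continuous (fun t : R => mu `]-oo, t]%classic)} ->
    cdf (X k) x @[k --> \oo] --> mu `]-oo, x]%classic.

Arguments cvg_in_distribution {R d T} P X mu.

(* Main.v *)
Require Import Defs.
From HB Require Import structures.
From mathcomp Require Import all_boot all_order all_algebra.
From mathcomp Require Import all_classical all_reals all_analysis.
From mathcomp Require Import measurable_realfun ring lra zify.

Import Order.TTheory GRing.Theory Num.Theory.
Import numFieldNormedType.Exports.

Local Open Scope classical_set_scope.
Local Open Scope ring_scope.

(** Write [p] for the probability mass function with parameters [(2m, m, c)],
    [s = sqrt (2c)] for the scale, and [H] for the half-normal distribution
    function. Consecutive values of [p] have the ratio
      [(1 - (y+2) / (2(c+y+1))) * (1 - y / (2m-2c-y))].
    When [c] is of order [sqrt m] and [y] of order [s], the second factor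
    multiplies to 1 in the limit and the first one to [exp (- (y/s)^2 / 2)], so
    [p y / p 0] has the Gaussian shape. Neither Stirling's formula nor the value
    of the Gaussian integral enters, because both laws have total mass 1: it is
    enough to know [p] up to a constant.

    To exploit this, [p y] is compared with the half-normal mass [q y] of the
    cell between [y/s] and [(y+1)/s]. On [y <= t * s] the quotient [p y / q y]
    lies between [K * exp (- 3/t)] and [K * exp (3/t)] for a constant [K]
    independent of [y] ([mnh_pmf_le_cell], [mnh_pmf_ge_cell]). Summing up to any
    [n <= M = floor (t * s)], and dividing by the sum up to [M], eliminates [K].
    What lies beyond [M] is negligible: on the half-normal side by
    [half_normal_cdf_cvg1], on the discrete side by [mnh_pmf_tail], which
    telescopes the recursion for [p].

    The cutoff [t] has to tend to infinity, but slowly enough for the Gaussian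
    approximation to hold up to [t * s]. The choice [t = (2c)^(1/8)], that is
    [s = t^4], makes every error [O(1/t)] and yields the two-sided bound
    [mnh_sum_sandwich]; with [n = floor (x * s)] both its ends tend to [H x]. *)

(** * Recursion for the mass function *)

Lemma mnh_pmf_ge0 (R : realType) (N m c y : nat) :
  0 <= max_neg_hypergeometric_pmf N m c y :> R.
Proof.
by rewrite /max_neg_hypergeometric_pmf; case: ifP.
Qed.

(** The falling factorial [m ^_ (c + y)] vanishes as soon as [y] leaves the
    support, so that a single formula covers all [y]; the recursion below can
    therefore be iterated without tracking the support. *)
Lemma mnh_pmf_halfE (R : realType) (m c y : nat) : (c <= m)%N ->
  max_neg_hypergeometric_pmf (2 * m) m c y =
  ('C(2 * c + y - 1, c - 1) * (2 * (m ^_ (c + y) * m ^_ c)))%:R /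
  ((2 * m) ^_ (2 * c + y))%:R :> R.
Proof.
move=> cm; rewrite /max_neg_hypergeometric_pmf.
have -> : (2 * m - m = m)%N by lia.
rewrite maxnn; case: leqP => ym.
  rewrite -natrD -natrM; congr (_%:R / _).
  by congr (_ * _)%N; ring.
by rewrite (@ffact_small m (c + y)) ?mul0n ?muln0 ?mul0r//; lia.
Qed.

Lemma mnh_pmfS (R : realType) (m c y : nat) : (0 < c <= m)%N ->
  max_neg_hypergeometric_pmf (2 * m) m c y.+1 =
  max_neg_hypergeometric_pmf (2 * m) m c y *
  (((2 * c + y) * (m - (c + y)))%:R /
   ((c + y).+1 * (2 * m - (2 * c + y)))%:R) :> R.
Proof.
move=> /andP[c0 cm]; rewrite !mnh_pmf_halfE// !addnS !ffactnSr mulf_div -!natrM.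
have -> : ((2 * c + y).+1 - 1 = 2 * c + y)%N by lia.
set D := ((2 * m) ^_ _)%N; set B := 'C(_, _); set B' := 'C(_, _).
have BB : ((2 * c + y) * B' = (c + y).+1 * B)%N.
  rewrite /B /B'; have -> : (2 * c + y - 1 = (2 * c + y).-1)%N by lia.
  by rewrite mul_bin_down; congr (_ * _)%N; lia.
have -> : (D * ((c + y).+1 * (2 * m - (2 * c + y))) =
  (c + y).+1 * (D * (2 * m - (2 * c + y))))%N by ring.
have -> : (B' * (2 * (m ^_ (c + y) * m ^_ c)) *
    ((2 * c + y) * (m - (c + y))) =
  (c + y).+1 * (B * (2 * (m ^_ (c + y) * (m - (c + y)) * m ^_ c))))%N.
  transitivity (((2 * c + y) * B') *
    (2 * (m ^_ (c + y) * (m - (c + y)) * m ^_ c)))%N; first by ring.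
  by rewrite BB; ring.
rewrite [X in _ = X / _]natrM [X in _ = _ / X]natrM -mulf_div.
by rewrite divff ?mul1r// pnatr_eq0.
Qed.

(** * Gaussian bounds and tail bound for the mass function *)

Section ratio_bounds.
Variables (R : realType) (m c : nat).
Hypothesis cm : (0 < c <= m)%N.
Local Notation p := (@max_neg_hypergeometric_pmf R (2 * m) m c).

(** The factor [2(m-c-y) / (2m-2c-y)] of the ratio is at most 1; dropping it
    bounds the ratio independently of [m]. *)
Lemma mnh_pmf_ratio_le (y : nat) :
  (2 * (c + y).+1)%:R * p y.+1 <= (2 * c + y)%:R * p y.
Proof.
rewrite mnh_pmfS// mulrCA [leRHS]mulrC ler_wpM2l ?mnh_pmf_ge0//.
have [my|my] := leqP m (c + y).
  by rewrite (_ : (m - (c + y) = 0)%N) ?muln0 ?mul0r ?mulr0//; lia.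
by rewrite mulrA -natrM ler_pdivrMr -?natrM ?ltr0n ?ler_nat; nia.
Qed.

(** The inverse ratio is the product of [1 + (y+2) / (2c+y)] and
    [1 + y / (2(m-c-y))], to which [1 + u <= exp u] applies. Bounding the
    inverse spares any lower bound for [ln (1 - u)]. *)
Lemma mnh_pmf_ratio_ge (y : nat) : (c + y < m)%N ->
  p y <= p y.+1 *
    expR ((y + 2)%:R / (2 * c)%:R + y%:R / (2 * (m - (c + y)))%:R).
Proof.
move=> my; rewrite mnh_pmfS// -mulrA -[leLHS]mulr1 ler_wpM2l ?mnh_pmf_ge0//.
have c0 : (0 < c)%N by case/andP: cm.
have {1}-> : 1 = (((2 * c + y) * (m - (c + y)))%:R /
   ((c + y).+1 * (2 * m - (2 * c + y)))%:R) *
   ((1 + (y + 2)%:R / (2 * c + y)%:R) *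
   (1 + y%:R / (2 * (m - (c + y)))%:R)) :> R.
  have -> : (2 * m - (2 * c + y) = 2 * (m - (c + y)) + y)%N by lia.
  have : (0 < m - (c + y))%N by lia.
  move: (m - (c + y))%N => d d0.
  rewrite -[(c + y).+1]addn1 !(natrM, natrD).
  have : 1 <= c%:R :> R by rewrite ler1n.
  have : 1 <= d%:R :> R by rewrite ler1n.
  have : 0 <= y%:R :> R by [].
  move: (c%:R : R) (d%:R : R) (y%:R : R) => C D X X0 D1 C1.
  by field; do ! (apply/andP; split); lra.
rewrite ler_wpM2l// expRD ler_pM ?addr_ge0//; last exact: expR_ge1Dx.
apply: le_trans (expR_ge1Dx _) _; rewrite ler_expR ler_wpM2l//.
by rewrite lef_pV2 ?posrE ?ltr0n ?ler_nat; lia.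
Qed.

Lemma mnh_pmf_nonincreasing (y : nat) : p y.+1 <= p y.
Proof.
have c0 : (0 < c)%N by case/andP: cm.
have /le_trans : (2 * (c + y).+1)%:R * p y.+1 <= (2 * (c + y).+1)%:R * p y.
  apply: (le_trans (mnh_pmf_ratio_le y)).
  by rewrite ler_wpM2r ?mnh_pmf_ge0// ler_nat; lia.
by move/(_ _ (lexx _)); rewrite ler_pM2l// ltr0n.
Qed.

(** The ratio at [j] is at most [exp (- (j+2) / (2(c+j+1)))], hence at most
    [exp (- (j+2) / (2(c+y)))] for [j < y], and the sum of [j+2] over [j < y]
    is at least [y^2 / 2]. *)
Lemma mnh_pmf_le_expR (y : nat) :
  p y <= p 0%N * expR (- (y%:R ^+ 2 / (4 * (c + y)%:R))).
Proof.
have c0 : (0 < c)%N by case/andP: cm.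
suff H i : (i <= y)%N ->
    p i <= p 0%N * expR (- (i%:R ^+ 2 / (4 * (c + y)%:R))) by exact: H.
elim: i => [_|i IH iy].
  by rewrite expr0n mul0r oppr0 expR0 mulr1.
have step : p i.+1 <= p i * expR (- ((i + 2)%:R / (2 * (c + i).+1)%:R)).
  have := mnh_pmf_ratio_le i; rewrite mulrC -ler_pdivlMr ?ltr0n// => /le_trans.
  apply; rewrite mulrAC mulrC ler_wpM2l ?mnh_pmf_ge0//.
  apply: le_trans (expR_ge1Dx _).
  rewrite le_eqVlt; apply/orP; left; apply/eqP.
  rewrite !natrM -addnS !natrD -natr1.
  field; apply: lt0r_neq0; have : 1 <= c%:R :> R by rewrite ler1n.
  by have : 0 <= i%:R :> R by []; lra.
apply: (le_trans step).
apply: le_trans (ler_wpM2r (expR_ge0 _) (IH (ltnW iy))) _.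
rewrite -mulrA -expRD ler_wpM2l ?mnh_pmf_ge0// ler_expR -opprD lerN2.
apply: (@le_trans _ _ (i%:R ^+ 2 / (4 * (c + y)%:R) +
                       (i + 2)%:R / (2 * (c + y)%:R))).
  have Z : 1 <= (c + y)%:R :> R by rewrite ler1n; lia.
  have -> : (i + 2)%:R / (2 * (c + y)%:R) =
            (2 * (i + 2)%:R) / (4 * (c + y)%:R) :> R by field; lra.
  rewrite -mulrDl ler_wpM2r ?invr_ge0 ?mulr_ge0// -natr1 natrD.
  by have : 0 <= i%:R :> R by []; nra.
by rewrite lerD2l ler_wpM2l// lef_pV2 ?posrE -?natrM ?ltr0n ?ler_nat; lia.
Qed.

(** Sum of the exponents of [mnh_pmf_ratio_ge]: that of [(j+2) / (2c)] over
    [j < y] is exactly [(y^2 + 3y) / (4c)], and each of the [y] terms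
    [j / (2(m-c-j))] is at most [y / (2(m-c-y))]. *)
Lemma mnh_pmf_ge_expR (y : nat) : (c + y < m)%N ->
  p 0%N <= p y * expR ((y%:R ^+ 2 + 3 * y%:R) / (4 * c%:R) +
                       y%:R ^+ 2 / (2 * (m - (c + y))%:R)).
Proof.
move=> my; have c0 : (0 < c)%N by case/andP: cm.
suff H i : (i <= y)%N ->
    p 0%N <= p i * expR ((i%:R ^+ 2 + 3 * i%:R) / (4 * c%:R) +
                       i%:R ^+ 2 / (2 * (m - (c + y))%:R)) by exact: H.
elim: i => [_|i IH iy].
  by rewrite expr0n mulr0 addr0 !mul0r addr0 expR0 mulr1.
apply: (le_trans (IH (ltnW iy))).
have ciym : (c + i < m)%N by lia.
have /(ler_wpM2r (expR_ge0 _)) step := mnh_pmf_ratio_ge _ ciym.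
apply: (le_trans (step _)).
rewrite -mulrA -expRD ler_wpM2l ?mnh_pmf_ge0// ler_expR addrACA.
apply: lerD.
  have Z : 1 <= c%:R :> R by rewrite ler1n; lia.
  rewrite le_eqVlt; apply/orP; left; apply/eqP.
  by rewrite -[i.+1]addn1 !(natrM, natrD); field; lra.
have Z : 1 <= (m - (c + y))%:R :> R by rewrite ler1n; lia.
apply: (@le_trans _ _ (i%:R / (2 * (m - (c + y))%:R) +
                       i%:R ^+ 2 / (2 * (m - (c + y))%:R))).
  by rewrite lerD2r ler_wpM2l// lef_pV2 ?posrE -?natrM ?ltr0n ?ler_nat; lia.
rewrite -mulrDl ler_wpM2r ?invr_ge0 ?mulr_ge0// -natr1.
by have : 0 <= i%:R :> R by []; nra.
Qed.

(** Since [2(c+y+1) = (2c+y+1) + (y+1)], the bound [mnh_pmf_ratio_le] also reads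
      [(y+1) * p (y+1) <= (2c+y) * p y - (2c+y+1) * p (y+1)],
    whose right-hand side telescopes: [(n+1)] times the tail is at most
    [(2c+n) * p n]. Moreover [p n <= 1 / (n+1)], as [p] is nonincreasing and its
    first [n+1] values sum to at most 1. *)
Lemma mnh_pmf_tail (n M : nat) : (n <= M)%N ->
  \sum_(0 <= y < n.+1) p y <= 1 ->
  \sum_(n <= y < M) p y.+1 <= (2 * c + n)%:R / n.+1%:R ^+ 2.
Proof.
move=> nM sum_le1.
have pn : p n <= n.+1%:R^-1.
  rewrite -[leRHS]mul1r ler_pdivlMr ?ltr0n//; apply: le_trans sum_le1.
  have -> : p n * n.+1%:R = \sum_(0 <= y < n.+1) p n.
    by rewrite sumr_const_nat subn0 mulr_natr.
  rewrite ler_sum_nat// => i /andP[_]; rewrite ltnS => iN.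
  have : {homo p : i j / (i <= j)%N >-> j <= i}.
    apply: (@homo_leq _ _ (fun a b => b <= a)) => //.
      by move=> a b d ab bd; exact: le_trans bd ab.
    exact: mnh_pmf_nonincreasing.
  exact.
have tele : n.+1%:R * \sum_(n <= y < M) p y.+1 <=
    (2 * c + n)%:R * p n - (2 * c + M)%:R * p M.
  rewrite mulr_sumr -[leRHS]opprB.
  rewrite -(@telescope_sumr _ n M (fun y => (2 * c + y)%:R * p y))// -sumrN.
  rewrite ler_sum_nat// => y /andP[ny _]; rewrite opprB lerBrDr.
  apply: le_trans (mnh_pmf_ratio_le y).
  by rewrite -mulrDl ler_wpM2r ?mnh_pmf_ge0// -natrD ler_nat; lia.
rewrite expr2 invfM mulrA ler_pdivlMr ?ltr0n// mulrC; apply: (le_trans tele).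
rewrite lerBlDr -[leLHS]addr0 lerD//; last by rewrite mulr_ge0// mnh_pmf_ge0.
by rewrite ler_wpM2l.
Qed.

End ratio_bounds.

(** * The half-normal distribution function *)

Section half_normal_cdf.
Variable R : realType.

Definition half_normal_cdf (x : R) : R :=
  fine (half_normal_prob R `]-oo, x]%classic).

Definition half_normal_pdf (x : R) : R :=
  Num.sqrt (2 / pi) * expR (- x ^+ 2 / 2).

Lemma half_normal_cdfE (x : R) :
  half_normal_prob R `]-oo, x]%classic = (half_normal_cdf x)%:E.
Proof. by rewrite /half_normal_cdf fineK// fin_num_measure. Qed.

Lemma half_normal_cdf_ge0 (x : R) : 0 <= half_normal_cdf x.
Proof. by rewrite -lee_fin -half_normal_cdfE. Qed.

Lemma half_normal_cdf_le1 (x : R) : half_normal_cdf x <= 1.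
Proof. by rewrite -lee_fin -half_normal_cdfE probability_le1. Qed.

Lemma measurable_half_normal_pdf (D : set R) :
  measurable_fun D (fun x => (half_normal_pdf x)%:E).
Proof.
apply/measurable_EFinP/measurable_funTS; apply: measurable_funM => //.
apply: (measurableT_comp (@measurable_expR R)).
apply: measurable_funM => //.
by apply: (measurableT_comp (@oppr_measurable R setT)); exact: exprn_measurable.
Qed.

Lemma half_normal_pdf_ge0 (x : R) : 0 <= half_normal_pdf x.
Proof. by rewrite mulr_ge0 ?sqrtr_ge0 ?expR_ge0. Qed.

Lemma half_normal_pdf_le (a b : R) : 0 <= a -> a <= b ->
  half_normal_pdf b <= half_normal_pdf a.
Proof.
move=> a0 ab; rewrite ler_wpM2l ?sqrtr_ge0// ler_expR !mulNr lerN2.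
by rewrite ler_pM2r// ler_sqr// nnegrE (le_trans a0).
Qed.

Lemma half_normal_cdf_le0 (x : R) : x <= 0 -> half_normal_cdf x = 0.
Proof.
move=> x0; apply: EFin_inj; rewrite -half_normal_cdfE.
rewrite half_normal_prob_density//.
apply: null_set_integral => //; first exact: measurableI.
  exact: measurable_half_normal_pdf.
apply/eqP; rewrite -measure_le0 -(@lebesgue_measure_set1 R 0).
apply: le_measure; rewrite ?inE//; first exact: measurableI.
move=> y /= []; rewrite !in_itv/= andbT => yx y0.
by apply/eqP; rewrite eq_le y0 (le_trans yx).
Qed.

Lemma half_normal_cdfB (a b : R) : a <= b ->
  half_normal_prob R `]a, b]%classic =
  (half_normal_cdf b - half_normal_cdf a)%:E.
Proof.
move=> ab; have : half_normal_prob R `]-oo, b]%classic =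
  (half_normal_prob R `]-oo, a]%classic + half_normal_prob R `]a, b]%classic)%E.
  rewrite (@itv_bndbnd_setU _ _ _ (BRight a))// measureU//.
  apply/seteqP; split => // y [] /=; rewrite !in_itv/= => ya /andP[].
  by rewrite ltNge ya.
by rewrite !half_normal_cdfE EFinB => ->; rewrite addeAC subee// add0e.
Qed.

(** The density decreases on the positive half-line, so on an interval it lies
    between its values at the two endpoints. *)
Lemma half_normal_cdf_increment (a b : R) : 0 <= a -> a <= b ->
  half_normal_pdf b * (b - a) <= half_normal_cdf b - half_normal_cdf a <=
  half_normal_pdf a * (b - a).
Proof.
move=> a0 ab; rewrite -!lee_fin -half_normal_cdfB// half_normal_prob_density//.
have -> : `]a, b]%classic `&` `[0%R, +oo[%classic = `]a, b]%classic :> set R.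
  apply/setIidPl => y /=; rewrite !in_itv/= andbT => /andP[ay _].
  exact: le_trans a0 (ltW ay).
have len k : (\int[lebesgue_measure]_(x in `]a, b]%classic) cst k%:E x =
    (k * (b - a))%:E)%E.
  rewrite integral_cst//= lebesgue_measure_itv/= lte_fin.
  by case: ltP => // ba; rewrite mule0 (@le_anti _ _ a b) ?ab// subrr mulr0.
apply/andP; split; rewrite -len; apply: ge0_le_integral => //.
- by move=> x _; rewrite lee_fin half_normal_pdf_ge0.
- exact: measurable_half_normal_pdf.
- move=> x /=; rewrite in_itv/= => /andP[ax xb].
  by rewrite lee_fin half_normal_pdf_le// (le_trans a0 (ltW ax)).
- exact: measurable_half_normal_pdf.
- move=> x /=; rewrite in_itv/= => /andP[ax xb].
  by rewrite lee_fin half_normal_pdf_le// ltW.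
Qed.

Lemma half_normal_cdf_nondecreasing : nondecreasing_fun half_normal_cdf.
Proof.
move=> a b ab; rewrite -lee_fin -!half_normal_cdfE le_measure ?inE//.
exact: subitvPr.
Qed.

(* The identity, seen as a random variable of half-normal law: its distribution
   function is [half_normal_cdf], which therefore tends to 1 at infinity. *)
Let idR : measurableTypeR R -> R := idfun.

#[local] HB.instance Definition _ :=
  @isMeasurableFun.Build _ _ _ _ idR (@measurable_id _ _ setT).

Lemma half_normal_cdf_cvg1 : half_normal_cdf x @[x --> +oo] --> (1 : R).
Proof. exact/fine_cvg/(cvg_cdfy1 (idR : {RV half_normal_prob R >-> R})). Qed.

End half_normal_cdf.

(** * Distribution function of an integer-valued random variable *)

Section nat_valued_law.
Context d (T : measurableType d) (R : realType) (P : probability T R).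
Variables (Y : {RV P >-> nat}) (p : nat -> R).
Hypothesis law : forall y, P (Y @^-1` [set y]) = (p y)%:E.

Let measurable_nat_le (n : nat) : measurable [set w | (Y w <= n)%N].
Proof. exact: (measurable_funPTI Y (Y := [set k | (k <= n)%N])). Qed.

Lemma nat_law_le (n : nat) :
  P [set w | (Y w <= n)%N] = (\sum_(0 <= y < n.+1) p y)%:E.
Proof.
elim: n => [|n IH].
  rewrite big_nat1 -law; congr (P _); apply/seteqP.
  by split=> w /=; [rewrite leqn0 => /eqP|move=> ->].
rewrite big_nat_recr//= EFinD -IH -law -measureU; last 3 first.
- exact: measurable_nat_le.
- exact: measurable_funPTI.
- by apply/seteqP; split => // w [] /= + wn; rewrite wn ltnn.
congr (P _); apply/seteqP; split=> w /=.
  by rewrite leq_eqVlt => /orP[/eqP|]; [right|left].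
by case=> [/leqW//|->].
Qed.

Lemma nat_law_sum_le1 (n : nat) : \sum_(0 <= y < n.+1) p y <= 1.
Proof. by rewrite -lee_fin -nat_law_le probability_le1. Qed.

Lemma nat_law_sum_cvg1 : \sum_(0 <= y < n.+1) p y @[n --> \oo] --> (1 : R).
Proof.
have UT : \bigcup_n [set w | (Y w <= n)%N] = setT.
  by apply/seteqP; split => // w _; exists (Y w) => /=.
have /fine_cvg : P [set w | (Y w <= n)%N] @[n --> \oo] --> (1 : R)%:E.
  rewrite -(probability_setT P) -UT; apply: nondecreasing_cvg_mu => //.
    by rewrite UT.
  by move=> n k nk; apply/subsetPset => w /= /leq_trans; apply.
by apply: cvg_trans; apply: near_eq_cvg; near=> n; rewrite /= nat_law_le.
Unshelve. all: by end_near. Qed.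

Lemma cdf_RV_ratio (a x : R) : 0 < a ->
  cdf (RV_ratio Y a : {RV P >-> R}) x =
  if 0 <= x then (\sum_(0 <= y < (Num.truncn (x * a)).+1) p y)%:E else 0%E.
Proof.
move=> a0; rewrite /cdf /distribution /pushforward /=.
case: (leP 0 x) => x0.
  have xa : 0 <= x * a by rewrite mulr_ge0// ltW.
  rewrite -nat_law_le; congr (P _); apply/seteqP.
  by split=> w /=; rewrite in_itv/= /RV_ratio ler_pdivrMr// truncn_ge_nat.
rewrite -(measure0 P); congr (P _); rewrite -subset0 => w /=.
by rewrite in_itv/= leNgt (lt_le_trans x0)// divr_ge0// ltW.
Qed.

End nat_valued_law.

(** * Comparison of the two laws cell by cell *)

(** The scale is [s = t^4], and [y <= t^5] means [y / s <= t]. Since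
    [c^2 = t^16 / 4], the hypothesis [mt] says that [c] is at most twice the
    square root of [N = 2m]; together with [3 <= t] it keeps [2(m - c - y)]
    above [t^12] for all [y <= t^5]. *)
Section comparison.
Variables (R : realType) (m c : nat) (t : R).
Hypothesis cm : (0 < c <= m)%N.
Hypothesis t3 : 3 <= t.
Hypothesis ct : 2 * c%:R = t ^+ 8.
Hypothesis mt : t ^+ 16 / 16 <= 2 * m%:R.
Local Notation p := (@max_neg_hypergeometric_pmf R (2 * m) m c).

Let t0 : 0 < t. Proof. by apply: lt_le_trans t3. Qed.

Let t1 : 1 <= t. Proof. by have := t3; lra. Qed.

Let xge0 k : 0 <= t ^+ k. Proof. by rewrite exprn_ge0// ltW. Qed.
Let xgt0 k : 0 < t ^+ k. Proof. by rewrite exprn_gt0. Qed.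
Let xle k l : (k <= l)%N -> t ^+ k <= t ^+ l.
Proof. by move=> kl; rewrite ler_weXn2l. Qed.

(** Replacing [y^2 / (4(c+y))] by [y^2 / (4c)] costs at most
    [y^3 / (4c^2) = y^3 / t^16], which is at most [1/t]. *)
Lemma mnh_pmf_le_gauss (y : nat) : y%:R <= t ^+ 5 ->
  p y <= p 0%N * expR (- (y%:R / t ^+ 4) ^+ 2 / 2 + t^-1).
Proof.
move=> yt; have := ct => ct'; apply: (le_trans (mnh_pmf_le_expR _ _ _ cm _)).
rewrite ler_wpM2l ?mnh_pmf_ge0// ler_expR natrD.
have -> : c%:R = t ^+ 8 / 2 :> R by rewrite -ct; field.
set Y : R := y%:R; have Y0 : 0 <= Y by [].
rewrite -subr_ge0.
have -> : - (Y / t ^+ 4) ^+ 2 / 2 + t^-1 -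
    - (Y ^+ 2 / (4 * (t ^+ 8 / 2 + Y))) =
  (t ^+ 15 + 2 * Y * t ^+ 7 - Y ^+ 3) / (t ^+ 16 + 2 * Y * t ^+ 8).
  field; do ! (apply/andP; split); rewrite ?gt_eqF//; have := xgt0 8.
    by have := mulr_ge0 Y0 (xge0 8); have := xgt0 16; lra.
  by lra.
rewrite divr_ge0//; last by rewrite addr_ge0// mulr_ge0// mulr_ge0.
have : Y ^+ 3 <= t ^+ 15.
  by rewrite (_ : t ^+ 15 = (t ^+ 5) ^+ 3) ?lerXn2r ?nnegrE// -exprM.
by have := mulr_ge0 Y0 (xge0 7); lra.
Qed.

(** The excess over [y^2 / (4c)] in [mnh_pmf_ge_expR] is [3y / (4c)], at most
    [3 / (2t^3)], plus a term at most [y^2 / t^12], itself at most [1 / t^2]. *)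
Lemma mnh_pmf_ge_gauss (y : nat) : y%:R <= t ^+ 5 ->
  p 0%N <= p y * expR ((y%:R / t ^+ 4) ^+ 2 / 2 + t^-1).
Proof.
move=> yt; have [t3' ct' mt'] := And3 t3 ct mt.
have x12 : 9 ^+ 2 * t ^+ 12 <= t ^+ 16.
  rewrite (_ : t ^+ 16 = (t ^+ 2) ^+ 2 * t ^+ 12); last by ring.
  by rewrite ler_wpM2r// lerXn2r ?nnegrE//; nra.
have x8 : t ^+ 8 <= t ^+ 12 by exact: xle.
have x5 : t ^+ 5 <= t ^+ 12 by exact: xle.
have x12' := xgt0 12.
have lem : t ^+ 12 <= 2 * (m%:R - (c%:R + y%:R)) by lra.
have cym : (c + y < m)%N by rewrite -(ltr_nat R) natrD; lra.
apply: (le_trans (mnh_pmf_ge_expR _ _ _ cm _ cym)).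
rewrite ler_wpM2l ?mnh_pmf_ge0// ler_expR natrB ?natrD; last exact: ltnW.
have -> : 4 * c%:R = 2 * t ^+ 8 :> R by lra.
set Y : R := y%:R; have Y0 : 0 <= Y by [].
have Yt : Y <= t ^+ 5 by [].
apply: (@le_trans _ _ ((Y ^+ 2 + 3 * Y) / (2 * t ^+ 8) + Y ^+ 2 / t ^+ 12)).
  by rewrite lerD2l ler_wpM2l ?exprn_ge0// lef_pV2 ?posrE//; lra.
have Y2 : Y ^+ 2 <= t ^+ 10.
  by rewrite (_ : t ^+ 10 = (t ^+ 5) ^+ 2) ?lerXn2r ?nnegrE// -exprM.
rewrite -subr_ge0.
have -> : (Y / t ^+ 4) ^+ 2 / 2 + t^-1 -
    ((Y ^+ 2 + 3 * Y) / (2 * t ^+ 8) + Y ^+ 2 / t ^+ 12) =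
  (2 * t ^+ 11 - 3 * t ^+ 4 * Y - 2 * Y ^+ 2) / (2 * t ^+ 12).
  by field; rewrite gt_eqF.
apply: divr_ge0; last by rewrite mulr_ge0.
have h1 : t ^+ 4 * Y <= t ^+ 9.
  by rewrite (exprD t 4 5) ler_wpM2l.
have h2 : 9 * t ^+ 9 <= t ^+ 11.
  by rewrite (exprD t 2 9) ler_wpM2r//; have := t3; nra.
have h3 : 3 * t ^+ 10 <= t ^+ 11 by rewrite (exprS t 10) ler_wpM2r.
by have := xge0 11; lra.
Qed.

Let kappa : R := Num.sqrt (2 / pi).

(** The value that [p y / q y] approaches for small [y]. It is never computed:
    only its independence of [y] matters. *)
Let K : R := p 0%N * t ^+ 4 / kappa.

(* The half-normal mass of the cell from y / s to (y+1) / s. *)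
Local Notation q y := (half_normal_cdf R (y.+1%:R / t ^+ 4) -
                       half_normal_cdf R (y%:R / t ^+ 4)).

Let kappa_gt0 : 0 < kappa.
Proof. by rewrite sqrtr_gt0 divr_gt0// pi_gt0. Qed.

Let K_ge0 : 0 <= K.
Proof. by rewrite !(mulr_ge0, invr_ge0)// ?mnh_pmf_ge0// ltW. Qed.

Let q_bounds (y : nat) :
  kappa * expR (- (y.+1%:R / t ^+ 4) ^+ 2 / 2) / t ^+ 4 <= q y <=
  kappa * expR (- (y%:R / t ^+ 4) ^+ 2 / 2) / t ^+ 4.
Proof.
have le0 : 0 <= y%:R / t ^+ 4 :> R by rewrite divr_ge0.
have le1 : y%:R / t ^+ 4 <= y.+1%:R / t ^+ 4 :> R.
  by rewrite ler_pM2r ?invr_gt0// ler_nat.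
have := half_normal_cdf_increment R _ _ le0 le1.
have -> // : y.+1%:R / t ^+ 4 - y%:R / t ^+ 4 = (t ^+ 4)^-1 :> R.
by rewrite -mulrBl -natrB// subSnn mul1r.
Qed.

(** Besides the error [1/t] of [mnh_pmf_le_gauss], the Gaussian exponent moves
    by [(2y+1) / (2t^8)], at most [2/t], from one end of the cell to the other. *)
Lemma mnh_pmf_le_cell (y : nat) : y%:R <= t ^+ 5 ->
  p y <= K * expR (3 / t) * q y.
Proof.
move=> yt; have /andP[qge _] := q_bounds y.
apply: (le_trans (mnh_pmf_le_gauss _ yt)).
rewrite -mulrA.
apply: le_trans (ler_wpM2l K_ge0 (ler_wpM2l (expR_ge0 _) qge)).
have -> : K * (expR (3 / t) *
    (kappa * expR (- (y.+1%:R / t ^+ 4) ^+ 2 / 2) / t ^+ 4)) =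
  p 0%N * expR (3 / t - (y.+1%:R / t ^+ 4) ^+ 2 / 2).
  by rewrite mulNr expRD /K; field; rewrite !gt_eqF.
rewrite ler_wpM2l ?mnh_pmf_ge0// ler_expR -[y.+1%:R]natr1 -subr_ge0.
set Y : R := y%:R; have Y0 : 0 <= Y by [].
have -> : 3 / t - ((Y + 1) / t ^+ 4) ^+ 2 / 2 -
    (- (Y / t ^+ 4) ^+ 2 / 2 + t^-1) =
  (4 * t ^+ 7 - 2 * Y - 1) / (2 * t ^+ 8) by field; rewrite gt_eqF.
apply: divr_ge0; last by rewrite mulr_ge0.
have h1 : t ^+ 5 <= t ^+ 7 by exact: xle.
have h2 : t ^+ 0 <= t ^+ 7 by exact: xle.
have : Y <= t ^+ 5 by [].
by move: h2; rewrite expr0; lra.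
Qed.

Lemma mnh_pmf_ge_cell (y : nat) : y%:R <= t ^+ 5 ->
  K * q y <= p y * expR (3 / t).
Proof.
move=> yt; have /andP[_ qle] := q_bounds y.
apply: (le_trans (ler_wpM2l K_ge0 qle)).
have -> : K * (kappa * expR (- (y%:R / t ^+ 4) ^+ 2 / 2) / t ^+ 4) =
  p 0%N * expR (- (y%:R / t ^+ 4) ^+ 2 / 2).
  by rewrite /K; field; rewrite !gt_eqF.
apply: (le_trans (ler_wpM2r (expR_ge0 _) (mnh_pmf_ge_gauss _ yt))).
rewrite -mulrA -expRD ler_wpM2l ?mnh_pmf_ge0// ler_expR.
rewrite mulNr addrAC subrr add0r -[leLHS]mul1r ler_wpM2r ?invr_ge0//.
  exact: ltW.
by rewrite ler1n.
Qed.

Local Notation F n := (\sum_(0 <= y < n.+1) p y).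
Local Notation Q n := (half_normal_cdf R (n.+1%:R / t ^+ 4)).

Let sum_q (n : nat) : \sum_(0 <= y < n.+1) q y = Q n.
Proof.
by rewrite telescope_sumr// mul0r (half_normal_cdf_le0 R 0)// subr0.
Qed.

Lemma mnh_sum_le_cells (n : nat) : n%:R <= t ^+ 5 ->
  F n <= K * expR (3 / t) * Q n.
Proof.
move=> nt; rewrite -sum_q mulr_sumr ler_sum_nat// => y /andP[_].
rewrite ltnS => yn.
by apply: mnh_pmf_le_cell; apply: le_trans nt; rewrite ler_nat.
Qed.

Lemma mnh_sum_ge_cells (n : nat) : n%:R <= t ^+ 5 ->
  K * Q n <= F n * expR (3 / t).
Proof.
move=> nt; rewrite -sum_q mulr_sumr mulr_suml ler_sum_nat// => y /andP[_].
rewrite ltnS => yn.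
by apply: mnh_pmf_ge_cell; apply: le_trans nt; rewrite ler_nat.
Qed.

Hypothesis F_le1 : forall n, F n <= 1.
Hypothesis F_cvg1 : F n @[n --> \oo] --> (1 : R).

Let M := Num.truncn (t ^+ 5).

Let M_le : M%:R <= t ^+ 5. Proof. by rewrite truncn_le. Qed.

Let M_gt : t ^+ 5 < M.+1%:R. Proof. by rewrite truncnS_gt. Qed.

(** Beyond [M] the tail is at most [(2c+M) / (M+1)^2], hence at most
    [(t^8 + t^5) / t^10]. *)
Lemma mnh_sum_truncn_ge : 1 - 2 / t <= F M.
Proof.
have : forall n, (M <= n)%N -> F n <= F M + 2 / t.
  move=> n Mn; rewrite (big_cat_nat (n := M.+1))//=.
  rewrite lerD2l big_add1/=.
  apply: (le_trans (mnh_pmf_tail R _ _ cm _ _ Mn (F_le1 _))).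
  have h : (t ^+ 5) ^+ 2 <= M.+1%:R ^+ 2 :> R by rewrite lerXn2r ?nnegrE// ltW.
  apply: (@le_trans _ _ ((t ^+ 8 + t ^+ 5) / (t ^+ 5) ^+ 2)).
    rewrite natrD natrM ct; apply: ler_pM.
    - exact: addr_ge0.
    - by rewrite invr_ge0 exprn_ge0.
    - by rewrite lerD2l.
    - by rewrite lef_pV2// posrE exprn_gt0.
  rewrite -subr_ge0.
  have -> : 2 / t - (t ^+ 8 + t ^+ 5) / (t ^+ 5) ^+ 2 =
    (2 * t ^+ 9 - t ^+ 8 - t ^+ 5) / t ^+ 10 by field; rewrite gt_eqF.
  rewrite divr_ge0//.
  have : t ^+ 8 <= t ^+ 9 by exact: xle.
  have : t ^+ 5 <= t ^+ 9 by exact: xle.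
  by lra.
move=> H; rewrite lerBlDr.
apply: (cvgr_to_le F_cvg1).
by near=> n; apply: H; near: n; exact: nbhs_infty_ge.
Unshelve. all: by end_near. Qed.

(** Both bounds come from comparing [F n / F M] with [Q n / Q M], in which [K]
    cancels. The normalising sums satisfy [1 - 2/t <= F M <= 1] and
    [H t <= Q M <= 1], the latter because [M + 1] exceeds [t * s]. *)
Lemma mnh_sum_sandwich (n : nat) : n%:R <= t ^+ 5 ->
  expR (- (6 / t)) * (1 - 2 / t) * Q n <= F n <=
  expR (6 / t) * Q n / half_normal_cdf R t.
Proof.
move=> nt; set E := expR (3 / t).
have E_gt0 : 0 < E by exact: expR_gt0.
have E6 : expR (6 / t) = E * E.
  by rewrite -expRD; congr expR; field; rewrite gt_eqF.
have Q0 k : 0 <= Q k by rewrite half_normal_cdf_ge0.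
have Ht0 : 0 < half_normal_cdf R t.
  have /andP[+ _] := half_normal_cdf_increment R 0 t (lexx _) (ltW t0).
  rewrite (half_normal_cdf_le0 R 0)// !subr0; apply: lt_le_trans.
  by rewrite mulr_gt0// mulr_gt0// expR_gt0.
have HtQ : half_normal_cdf R t <= Q M.
  apply: half_normal_cdf_nondecreasing.
  by rewrite ler_pdivlMr// -exprS; exact: ltW.
have Fn_le := mnh_sum_le_cells _ nt.
have Fn_ge := mnh_sum_ge_cells _ nt.
have FM_le := mnh_sum_le_cells _ M_le.
have FM_ge := mnh_sum_ge_cells _ M_le.
have KE : 0 <= K * E by rewrite mulr_ge0// ltW.
apply/andP; split.
  rewrite expRN E6 -mulrA ler_pdivrMl ?mulr_gt0//.
  apply: (@le_trans _ _ (F M * Q n)).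
    by rewrite ler_wpM2r// mnh_sum_truncn_ge.
  apply: (@le_trans _ _ (K * E * Q n)).
    rewrite ler_wpM2r//; apply: (le_trans FM_le).
    by rewrite -[leRHS]mulr1 ler_wpM2l// half_normal_cdf_le1.
  have -> : K * E * Q n = E * (K * Q n) by ring.
  have -> : E * E * F n = E * (F n * E) by ring.
  by rewrite ler_pM2l.
rewrite ler_pdivlMr// E6.
apply: (@le_trans _ _ (K * E * Q n * Q M)).
  apply: ler_pM => //; last exact: ltW.
  by rewrite big_nat sumr_ge0// => y _; exact: mnh_pmf_ge0.
have -> : K * E * Q n * Q M = E * Q n * (K * Q M) by ring.
have -> : E * E * Q n = E * Q n * E by ring.
rewrite ler_wpM2l ?mulr_ge0 ?(ltW E_gt0)//; apply: (le_trans FM_ge).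
by rewrite -[leRHS]mul1r ler_wpM2r// ltW.
Qed.

End comparison.

(** * Passage to the limit *)

Lemma cvgry_sqrt (R : realType) (T : Type) (F : set_system T) {FF : Filter F}
    (f : T -> R) :
  f x @[x --> F] --> +oo -> Num.sqrt (f x) @[x --> F] --> +oo.
Proof.
move=> foo; apply/cvgryPge => A.
have : \forall x \near F, A ^+ 2 <= f x by move/cvgryPge : foo; exact.
apply: filterS => x /ler_wsqrtr; apply: le_trans.
by rewrite sqrtr_sqr ler_norm.
Qed.

Lemma scaled_truncn_cvg (R : realType) (T : Type) (F : set_system T)
    {FF : Filter F} (s : T -> R) (x : R) : 0 <= x ->
  s k @[k --> F] --> +oo ->
  (Num.truncn (x * s k)).+1%:R / s k @[k --> F] --> x.
Proof.
move=> x0 soo.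
have s_gt0 : \forall k \near F, 0 < s k by move/cvgryPgt : soo; exact.
apply: (@squeeze_cvgr _ _ _ _ (fun=> x) (fun k => x + (s k)^-1)); last 2 first.
- exact: cvg_cst.
- rewrite -[X in _ --> X]addr0; apply: cvgD; first exact: cvg_cst.
  exact: (gtr0_cvgV0 s_gt0).2.
near=> k; have sk : 0 < s k by near: k.
rewrite ler_pdivlMr// ler_pdivrMr// mulrDl mulVf ?gt_eqF//.
by rewrite (ltW (truncnS_gt _))/= -natr1 lerD2r truncn_le mulr_ge0// ltW.
Unshelve. all: by end_near. Qed.

Theorem lemma3 (R : realType) (N c : nat -> nat)
    (N_gt0 : forall k, (0 < N k)%N)
    (N_even : forall k, ~~ odd (N k))
    (N_oo : N k @[k --> \oo] --> \oo)
    (c_bounds : forall k, (1 <= c k <= (N k)./2)%N)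
    (c_sqrtN : (c k)%:R / Num.sqrt (N k)%:R @[k --> \oo] --> (1 : R))
    (d : nat -> measure_display) (T : forall k, measurableType (d k))
    (P : forall k, probability (T k) R) (Y : forall k, {RV P k >-> nat})
    (Y_law : forall k,
       max_neg_hypergeometric (N k) (N k)./2 (c k) (Y k)) :
  cvg_in_distribution P
    (fun k => RV_ratio (Y k) (Num.sqrt (2 * (c k)%:R)))
    (@half_normal_prob R).
Proof.
have N2 k : N k = (2 * (N k)./2)%N by have := N_even k; lia.
pose s k : R := Num.sqrt (2 * (c k)%:R).
pose t k : R := Num.sqrt (Num.sqrt (s k)).
have c_gt0 k : 0 < 2 * (c k)%:R :> R.
  by rewrite mulr_gt0// ltr0n; case/andP: (c_bounds k).
have s_gt0 k : 0 < s k by rewrite sqrtr_gt0.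
have t4 k : t k ^+ 4 = s k.
  by rewrite (exprM _ 2 2) sqr_sqrtr ?sqrtr_ge0// sqr_sqrtr// ltW.
have t8 k : 2 * (c k)%:R = t k ^+ 8.
  by rewrite (exprM _ 4 2) t4 sqr_sqrtr// ltW.
have Nr_oo : (N k)%:R @[k --> \oo] --> (+oo : set_system R).
  exact: (cvg_comp _ _ N_oo cvgr_idn).
have c_oo : 2 * (c k)%:R @[k --> \oo] --> (+oo : set_system R).
  apply/cvgryPge => A.
  have h : \forall k \near \oo, 2^-1 <= (c k)%:R / Num.sqrt (N k)%:R :> R.
    by apply: cvgr_ge c_sqrtN _ _; lra.
  have g : \forall k \near \oo, A <= Num.sqrt (N k)%:R.
    by move/cvgry_sqrt/cvgryPge : Nr_oo; exact.
  near=> k.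
  have : 2^-1 <= (c k)%:R / Num.sqrt (N k)%:R :> R by near: k.
  have : A <= Num.sqrt (N k)%:R by near: k.
  by rewrite ler_pdivlMr ?sqrtr_gt0 ?ltr0n//; lra.
have s_oo : s k @[k --> \oo] --> +oo by exact: cvgry_sqrt.
have t_oo : t k @[k --> \oo] --> +oo by do 2 apply: cvgry_sqrt.
have t_ge A : \forall k \near \oo, A <= t k.
  by move/cvgryPge : t_oo; exact.
have t_inv : (t k)^-1 @[k --> \oo] --> (0 : R).
  by apply: (gtr0_cvgV0 _).2 => //; near=> k; rewrite !sqrtr_gt0.
have t_big : \forall k \near \oo, t k ^+ 16 / 16 <= 2 * ((N k)./2)%:R.
  have h : \forall k \near \oo, (c k)%:R / Num.sqrt (N k)%:R <= 2 :> R.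
    by apply: cvgr_le c_sqrtN _ _; lra.
  near=> k.
  have : (c k)%:R / Num.sqrt (N k)%:R <= 2 :> R by near: k.
  rewrite ler_pdivrMr ?sqrtr_gt0 ?ltr0n// => ck.
  have : (c k)%:R ^+ 2 <= (2 * Num.sqrt (N k)%:R) ^+ 2 :> R.
    by rewrite lerXn2r ?nnegrE ?mulr_ge0 ?sqrtr_ge0.
  by rewrite exprMn sqr_sqrtr// -natrM -N2 (exprM _ 8 2) -t8; lra.
move=> x Hx; rewrite -/(half_normal_cdf R x) half_normal_cdfE.
pose p k := @max_neg_hypergeometric_pmf R (2 * (N k)./2) (N k)./2 (c k).
have law k y : P k (Y k @^-1` [set y]) = (p k y)%:E.
  by rewrite Y_law {1}N2.
pose n k := Num.truncn (x * s k).
pose F k := \sum_(0 <= y < (n k).+1) p k y.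
have [x0|x0] := ltP x 0.
  rewrite (half_normal_cdf_le0 R x (ltW x0)); apply: cvg_near_cst; near=> k.
  by rewrite (cdf_RV_ratio _ _ _ _ _ _ (law k)) ?sqrtr_gt0// lt_geF.
suff Fx : F k @[k --> \oo] --> half_normal_cdf R x.
  have : (EFin \o F) k @[k --> \oo] --> (half_normal_cdf R x)%:E.
    by apply: cvg_EFin => //; near=> k.
  apply: cvg_trans; apply: near_eq_cvg; near=> k.
  by rewrite (cdf_RV_ratio _ _ _ _ _ _ (law k)) ?sqrtr_gt0// ifT.
(* The continuity of the limit at x comes from the very definition of
   convergence in distribution. *)
have Hcts : half_normal_cdf R y @[y --> x] --> half_normal_cdf R x.
  by apply: fine_cvg; rewrite -half_normal_cdfE.
have Qx : half_normal_cdf R ((n k).+1%:R / t k ^+ 4) @[k --> \oo] -->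
    half_normal_cdf R x.
  rewrite (_ : (fun k => _) =
    half_normal_cdf R \o (fun k => (n k).+1%:R / s k)); last first.
    by apply/funext => k /=; rewrite t4.
  by apply: (cvg_comp _ _ _ Hcts); exact: scaled_truncn_cvg.
have Ht1 : half_normal_cdf R (t k) @[k --> \oo] --> (1 : R).
  exact: (cvg_comp _ _ t_oo (half_normal_cdf_cvg1 R)).
have Ecvg a : expR (a * (t k)^-1) @[k --> \oo] --> (1 : R).
  have h : a * (t k)^-1 @[k --> \oo] --> (0 : R).
    by rewrite -[X in _ --> X](mulr0 a); apply: cvgMr.
  by rewrite -expR0; exact: (cvg_comp _ _ h (@continuous_expR R 0)).
apply: (@squeeze_cvgr _ _ _ _
  (fun k => expR (- (6 / t k)) * (1 - 2 / t k) *
     half_normal_cdf R ((n k).+1%:R / t k ^+ 4))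
  (fun k => expR (6 / t k) * half_normal_cdf R ((n k).+1%:R / t k ^+ 4) /
     half_normal_cdf R (t k))).
- near=> k; apply: mnh_sum_sandwich => //.
  + by near: k; exact: t_ge.
  + by near: k.
  + exact: nat_law_sum_le1 (law k).
  + exact: nat_law_sum_cvg1 (law k).
  + apply: (@le_trans _ _ (x * s k)).
      by rewrite truncn_le mulr_ge0// ltW.
    rewrite (exprS _ 4) t4 ler_wpM2r ?(ltW (s_gt0 k))//.
    by near: k; exact: t_ge.
- rewrite -[X in _ --> X]mul1r; apply: cvgM => //.
  rewrite -[X in _ --> X]mulr1; apply: cvgM.
    by under eq_cvg do rewrite -mulNr; exact: Ecvg.
  rewrite -[X in _ --> X]subr0; apply: cvgB; first exact: cvg_cst.
  by rewrite -[X in _ --> X](mulr0 2); apply: cvgMr.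
- rewrite -[X in _ --> X]divr1; apply: cvgM; last by apply: cvgV.
  by rewrite -[X in _ --> X]mul1r; apply: cvgM.
Unshelve. all: by end_near. Qed.
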